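(* Let $G=(V,E)$ be a graph with $n$ nodes and $m$ edges, and let $\mathcal{S}=a_1:\ldots:a_\ell$ be a hierarchy with integers $a_i\ge 2$ and $k=\prod_{i=1}^{\ell}a_i$. Online recursive multi-section along $\mathcal{S}$ coupled with Fennel or LDG as the scoring rule has time complexity $O\big(m\ell + n\sum_{i=1}^{\ell}a_i\big)$.
   Context: One-pass streaming model: nodes of $G$ arrive one at a time together with their neighborhood $N(u)$ and must be permanently assigned to a block on arrival. A hierarchy $\mathcal{S}=a_1:\ldots:a_\ell$ defines a tree of blocks: layer $\ell$ has $a_\ell$ blocks; each block of layer $i>1$ has $a_{i-1}$ sub-blocks in layer $i-1$; layer $1$ contains the $k$ final blocks. Online recursive multi-section: when node $u$ arrives, for $i=\ell,\ldots,1$ it chooses among the $a_i$ candidate blocks of layer $i$ (all top-layer blocks if $i=\ell$, otherwise the sub-blocks of the block chosen at layer $i+1$) the one maximizing a score, and assigns $u$ to it; weights of all blocks at all layers are maintained. Scores for a candidate block $W$ in layer $i$: Fennel uses $|W\cap N(u)|-\alpha_i\gamma|W|^{\gamma-1}$ (constants $\alpha_i,\gamma$); LDG uses $|W\cap N(u)|\,(1-|W|/L_i)$ with $L_i$ the block capacity at layer $i$. Assigning a node in one layer with these rules costs $O(|N(u)|+a_i)$ time. *)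

(* Defs.v *)
From HB Require Import structures.
From mathcomp Require Import all_boot all_order all_algebra.
From mathcomp Require Import reals exp.

Set Implicit Arguments.
Unset Strict Implicit.
Unset Printing Implicit Defensive.

Import Order.TTheory GRing.Theory Num.Theory.

(** Unit-cost real RAM: a timed value carries the number of elementary steps
    spent on it.  Every [step] below wraps exactly one array access, one
    arithmetic operation (on naturals or reals, real power included) or one
    comparison. *)

Definition timed (A : Type) : Type := (A * nat)%type.
Definition ret (A : Type) (x : A) : timed A := (x, 0).
Definition step (A : Type) (x : A) : timed A := (x, 1).
Definition bind (A B : Type) (m : timed A) (f : A -> timed B) : timed B :=
  ((f m.1).1, m.2 + (f m.1).2).
Definition result (A : Type) (m : timed A) : A := m.1.
Definition time (A : Type) (m : timed A) : nat := m.2.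

Notation "'do' x <- m ; k" := (bind m (fun x => k))
  (at level 200, x name, m at level 100, k at level 200,
   format "'[v' 'do'  x  <-  m ; '/' k ']'").

(** One step per iteration, and one for the test that leaves the loop. *)
Fixpoint loop (X S : Type) (xs : seq X) (s : S) (body : X -> S -> timed S)
    : timed S :=
  if xs is x :: xs' then
    do _ <- step tt; do s' <- body x s; loop xs' s' body
  else step s.

(** Arrays are total functions; every update below discards the old version,
    hence is an in-place write. *)
Definition upd (I : eqType) (T : Type) (f : I -> T) (i : I) (x : T) : I -> T :=
  fun j => if j == i then x else f j.

Definition edges (V : finType) (e : rel V) : {set {set V}} :=
  [set [set p.1; p.2] | p : V * V & e p.1 p.2].

Definition nbrs (V : finType) (e : rel V) (u : V) : seq V := enum (e u).

Inductive rule (R : realType) : Type :=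
  | Fennel (alpha : nat -> R) (gamma : R)
  | LDG (L : nat -> R).

(** [d] stands for |W :&: N(u)| and [w] for |W|, W a block of layer [i]. *)
Definition score (R : realType) (r : rule R) (i d w : nat) : R :=
  match r with
  | Fennel alpha gamma =>
      (d%:R - alpha i * gamma * (w%:R `^ (gamma - 1)))%R
  | LDG L => (d%:R * (1 - w%:R / L i))%R
  end.

Definition timed_score (R : realType) (r : rule R) (i d w : nat) : timed R :=
  do d' <- step (d%:R)%R;
  do w' <- step (w%:R)%R;
  match r with
  | Fennel alpha gamma =>
      do al <- step (alpha i);
      do c <- step (al * gamma)%R;
      do x <- step (gamma - 1)%R;
      do p <- step (w' `^ x)%R;
      do q <- step (c * p)%R;
      step (d' - q)%R
  | LDG L =>
      do Li <- step (L i);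
      do q <- step (w' / Li)%R;
      do f <- step (1 - q)%R;
      step (d' * f)%R
  end.

(** The blocks of layer [i] are numbered so that the sub-blocks in layer [i] of
    block [b] of layer [i+1] are b * a_i, ..., b * a_i + a_i - 1; the whole
    node set is block 0 of the fictitious layer [l+1]. *)
Definition candidates (a : nat -> nat) (i b : nat) : seq nat :=
  iota (b * a i) (a i).

(** [asg (i, v)] is the block of [v] in layer [i], [None] before [v] arrives;
    [wgt (i, b)] is the weight of block [b] of layer [i]; [cnt] is scratch
    space, whose content carries no information between two layers. *)
Record state (V : finType) : Type := State {
  asg : nat * V -> option nat;
  wgt : nat * nat -> nat;
  cnt : nat -> nat }.

(** Blocks start empty. *)
Definition init_state (V : finType) : state V :=
  State (fun _ => None) (fun _ => 0) (fun _ => 0).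

(** [c j] becomes the number of [v] in N(u) lying in block [lo + j]. *)
Definition tally (V : finType) (e : rel V) (u : V) (A : nat * V -> option nat)
    (i lo ai : nat) (c0 : nat -> nat) : timed (nat -> nat) :=
  do c1 <- loop (iota 0 ai) c0 (fun j c => step (upd c j 0));
  loop (nbrs e u) c1 (fun v c =>
    do x <- step (A (i, v));
    do known <- step (isSome x);
    if known then
      do ge <- step (lo <= odflt 0 x);
      if ge then
        do j <- step (odflt 0 x - lo);
        do lt <- step (j < ai);
        if lt then
          do d <- step (c j);
          do d' <- step d.+1;
          step (upd c j d')
        else ret c
      else ret c
    else ret c).

(** Candidate of maximal score, with that score.  [tie j] tells whether
    candidate [j] supersedes an earlier candidate of equal score; as [tie]
    varies, every maximizer is attained. *)
Definition best_candidate (R : realType) (r : rule R) (tie : nat -> bool)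
    (W : nat * nat -> nat) (c : nat -> nat) (i lo ai : nat)
    : timed (option (nat * R)) :=
  loop (iota 0 ai) None (fun j best =>
    do b <- step (lo + j);
    do w <- step (W (i, b));
    do d <- step (c j);
    do s <- timed_score r i d w;
    do found <- step (isSome best);
    if found then
      do gt <- step ((odflt (0%N, s) best).2 < s)%R;
      if gt then step (Some (j, s)) else
        do eq <- step ((odflt (0, s) best).2 == s);
        if eq then
          do t <- step (tie j);
          if t then step (Some (j, s)) else ret best
        else ret best
    else step (Some (j, s))).

(** Assigns [u] to a sub-block in layer [i] of block [b] of layer [i+1]; also
    returns that sub-block. *)
Definition assign_layer (R : realType) (V : finType) (e : rel V)
    (a : nat -> nat) (r : rule R) (tie : V -> nat -> nat -> bool)
    (u : V) (i b : nat) (s : state V) : timed (nat * state V) :=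
  do ai <- step (a i);
  do lo <- step (b * ai);
  do c <- tally e u (asg s) i lo ai (cnt s);
  do best <- best_candidate r (tie u i) (wgt s) c i lo ai;
  do b' <- step (lo + (odflt (0, 0%R) best).1);
  do w <- step (wgt s (i, b'));
  do w' <- step w.+1;
  do W <- step (upd (wgt s) (i, b') w');
  do A <- step (upd (asg s) (i, u) (Some b'));
  ret (b', State A W c).

(** Layers [i], [i-1], ..., 1, starting inside block [b] of layer [i+1]. *)
Fixpoint assign_node (R : realType) (V : finType) (e : rel V)
    (a : nat -> nat) (r : rule R) (tie : V -> nat -> nat -> bool)
    (u : V) (i b : nat) (s : state V) : timed (state V) :=
  do more <- step (0 < i);
  if i is i'.+1 then
    do bs <- assign_layer e a r tie u i b s;
    do j <- step i.-1;
    assign_node e a r tie u i' bs.1 bs.2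
  else ret s.

(** One call per arriving node. *)
Fixpoint process_stream (R : realType) (V : finType) (e : rel V) (l : nat)
    (a : nat -> nat) (r : rule R) (tie : V -> nat -> nat -> bool)
    (arrivals : seq V) (s : state V) : timed (state V) :=
  if arrivals is u :: us then
    do _ <- step tt;
    do s' <- assign_node e a r tie u l 0 s;
    process_stream e l a r tie us s'
  else ret s.

Definition multisection (R : realType) (V : finType) (e : rel V) (l : nat)
    (a : nat -> nat) (r : rule R) (tie : V -> nat -> nat -> bool)
    (arrivals : seq V) : timed (state V) :=
  process_stream e l a r tie arrivals (init_state V).

(** ** The program above performs online recursive multi-section *)

Definition parent (V : finType) (l : nat) (A : nat * V -> option nat)
    (i : nat) (u : V) : nat :=
  if i == l then 0 else odflt 0 (A (i.+1, u)).

(** Number of nodes of [p] (those that arrived before [u]) in block [b] of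
    layer [i], resp. of those that are neighbors of [u]. *)
Definition block_weight (V : finType) (A : nat * V -> option nat) (p : seq V)
    (i b : nat) : nat :=
  count (fun v => A (i, v) == Some b) p.
Definition block_nbrs (V : finType) (e : rel V) (A : nat * V -> option nat)
    (p : seq V) (u : V) (i b : nat) : nat :=
  count (fun v => e u v && (A (i, v) == Some b)) p.

Definition block_score (R : realType) (V : finType) (e : rel V) (r : rule R)
    (A : nat * V -> option nat) (p : seq V) (u : V) (i b : nat) : R :=
  score r i (block_nbrs e A p u i b) (block_weight A p i b).

Definition online_multisection (R : realType) (V : finType) (e : rel V)
    (l : nat) (a : nat -> nat) (r : rule R) (arrivals : seq V)
    (A : nat * V -> option nat) : Prop :=
  forall (p q : seq V) (u : V), arrivals = p ++ u :: q ->
  forall i : nat, 1 <= i <= l ->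
  exists b : nat,
    [/\ A (i, u) = Some b,
        b \in candidates a i (parent l A i u) &
        forall b' : nat, b' \in candidates a i (parent l A i u) ->
          (block_score e r A p u i b' <= block_score e r A p u i b)%R].

Lemma loop_result (X S : Type) (xs : seq X) (s : S) (body : X -> S -> timed S) :
  (loop xs s body).1 = foldl (fun s x => (body x s).1) s xs.
Proof. by elim: xs s => //= x xs IH s; rewrite IH. Qed.

Lemma tally_result (V : finType) (e : rel V) (u : V)
    (A : nat * V -> option nat) (i lo ai : nat) (c0 : nat -> nat) (j : nat) :
  j < ai ->
  (tally e u A i lo ai c0).1 j =
    count (fun v => A (i, v) == Some (lo + j)) (nbrs e u).
Proof.
move=> ltj; rewrite /tally /= !loop_result /=.
have zeroE xs (c : nat -> nat) :
    foldl (fun c k => upd c k 0) c xs j = if j \in xs then 0 else c j.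
  elim: xs c => //= x xs IH c; rewrite IH inE /upd.
  by case: eqP => //= _; case: ifP.
set f := (fun (s : nat -> nat) (x : V) => _).
have countE xs c : foldl f c xs j =
    c j + count (fun v => A (i, v) == Some (lo + j)) xs.
  elim: xs c => [|x xs IHx] c /=; first by rewrite addn0.
  rewrite IHx addnA; congr (_ + _); rewrite /f.
  case: (A (i, x)) => [y|] /=; last by rewrite addn0.
  have -> : (Some y == Some (lo + j)) = (y == lo + j) by [].
  case: leqP => [leq_y|lt_y] /=; last first.
    rewrite (_ : (_ == _) = false) ?addn0 //; apply/eqP => Ey.
    by move: lt_y; rewrite Ey ltnNge leq_addr.
  case: ltnP => [lt_ai|le_ai] /=; last first.
    rewrite (_ : (_ == _) = false) ?addn0 //; apply/eqP => Ey.
    by move: le_ai; rewrite Ey addKn leqNgt ltj.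
  rewrite /upd -(inj_eq (@addnI lo)) subnKC // eq_sym.
  by case: eqP => [->|_]; rewrite ?addn0 // addKn addn1.
by rewrite countE zeroE mem_iota add0n ltj.
Qed.

Lemma timed_score_result (R : realType) (r : rule R) (i d w : nat) :
  (timed_score r i d w).1 = score r i d w.
Proof. by case: r. Qed.

Lemma best_candidate_result (R : realType) (r : rule R) (tie : nat -> bool)
    (W : nat * nat -> nat) (c : nat -> nat) (i lo ai : nat) :
  0 < ai ->
  exists j : nat,
    [/\ j < ai,
        (odflt (0, 0%R) (best_candidate r tie W c i lo ai).1).1 = j &
        forall j', j' < ai ->
          (score r i (c j') (W (i, (lo + j')%N)) <=
             score r i (c j) (W (i, (lo + j)%N)))%R].
Proof.
case: ai => // n _; rewrite /best_candidate loop_result.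
set f := (fun (s : option (nat * R)) (x : nat) => _).
set sc := fun j => score r i (c j) (W (i, lo + j)).
have fE o j : f o j =
    if o is Some x then
      if (x.2 < sc j)%R then Some (j, sc j) else
      if x.2 == sc j then if tie j then Some (j, sc j) else o else o
    else Some (j, sc j).
  rewrite /f /sc -timed_score_result; case: o => [x|] //=.
  by case: ifP => // _; case: ifP => // _; case: ifP.
suff [j [ltj -> maxj]] : exists j, [/\ j < n.+1,
    foldl f None (iota 0 n.+1) = Some (j, sc j) &
    forall j', j' < n.+1 -> (sc j' <= sc j)%R].
  by exists j; split.
elim: n => [|n [j [ltj Ej maxj]]].
  exists 0; split=> //; first by rewrite /= fE.
  by case.
rewrite -[n.+2]addn1 iotaD foldl_cat Ej [foldl _ _ [:: _]]/= fE add0n /=.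
have lastE j' : j' < n.+2 -> j' = n.+1 \/ j' < n.+1.
  by rewrite ltnS leq_eqVlt => /orP[/eqP|]; [left|right].
rewrite addn1.
have [gt|le] := ltP (sc j) (sc n.+1).
  exists n.+1; split=> // j' /lastE[-> //|/maxj /le_trans]; apply.
  exact: ltW.
have [eq|_] := eqVneq (sc j) (sc n.+1); first case: (tie _).
- by exists n.+1; split=> // j' /lastE[-> //|/maxj]; rewrite eq.
- by exists j; split=> //; [exact: ltnW|move=> j' /lastE[->|/maxj]].
- by exists j; split=> //; [exact: ltnW|move=> j' /lastE[->|/maxj]].
Qed.

Section Correctness.
Variables (R : realType) (V : finType) (e : rel V) (l : nat) (a : nat -> nat).
Variables (r : rule R) (tie : V -> nat -> nat -> bool).
Hypothesis a_gt0 : forall i, 1 <= i <= l -> 0 < a i.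

Definition layer_inv (p : seq V) (s : state V) (i : nat) : Prop :=
  (forall v, isSome (asg s (i, v)) -> v \in p) /\
  (forall b, wgt s (i, b) = block_weight (asg s) p i b).

Lemma assign_layer_result (p : seq V) (u : V) (i b : nat) (s : state V) :
  uniq p -> 1 <= i <= l -> layer_inv p s i ->
  let t := (assign_layer e a r tie u i b s).1 in
  [/\ asg t.2 = upd (asg s) (i, u) (Some t.1),
      wgt t.2 = upd (wgt s) (i, t.1) (wgt s (i, t.1)).+1,
      t.1 \in candidates a i b &
      forall b', b' \in candidates a i b ->
        (block_score e r (asg s) p u i b' <=
           block_score e r (asg s) p u i t.1)%R].
Proof.
move=> Up li [inp wE].
pose c := (tally e u (asg s) i (b * a i) (a i) (cnt s)).1.
pose o := (best_candidate r (tie u i) (wgt s) c i (b * a i) (a i)).1.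
pose b1 := b * a i + (odflt (0, 0%R) o).1.
have -> : (assign_layer e a r tie u i b s).1 =
  (b1, State (upd (asg s) (i, u) (Some b1))
             (upd (wgt s) (i, b1) (wgt s (i, b1)).+1) c) by [].
have [j [ltj Ej maxj]] :=
  best_candidate_result r (tie u i) (wgt s) c i (b * a i) (a_gt0 li).
rewrite {}/b1 {}/o Ej /=.
have cE k : k < a i -> c k = block_nbrs e (asg s) p u i (b * a i + k).
  move=> ltk; rewrite /c tally_result // /block_nbrs -!size_filter.
  apply/perm_size/uniq_perm => [||v]; try exact/filter_uniq.
    exact/filter_uniq/enum_uniq.
  rewrite mem_filter [RHS]mem_filter /nbrs mem_enum.
  rewrite -[v \in e u]/(e u v) andbC -andbA; congr andb.
  by apply/idP/andP => [Av|[]//]; split=> //; apply: inp; rewrite (eqP Av).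
split=> //; first by rewrite mem_iota leq_addr ltn_add2l.
move=> b'; rewrite mem_iota => /andP[le_b' lt_b'].
have ltk : b' - b * a i < a i by rewrite ltn_subLR.
have := maxj _ ltk; rewrite !cE // subnKC // !wE.
exact.
Qed.

Lemma block_score_ext (A B : nat * V -> option nat) (p : seq V) (u : V) i b :
  (forall v, v \in p -> A (i, v) = B (i, v)) ->
  block_score e r A p u i b = block_score e r B p u i b.
Proof.
move=> AB; rewrite /block_score /block_nbrs /block_weight.
by congr score; apply: eq_in_count => v /AB ->.
Qed.

Definition good (A : nat * V -> option nat) (p : seq V) (u : V) (i b : nat) :=
  exists b1 : nat,
    [/\ A (i, u) = Some b1, b1 \in candidates a i b &
        forall b', b' \in candidates a i b ->
          (block_score e r A p u i b' <= block_score e r A p u i b1)%R].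

Lemma assign_node_result (p : seq V) (u : V) (i b : nat) (s : state V) :
  uniq p -> u \notin p -> i <= l -> (forall j, 1 <= j <= i -> layer_inv p s j) ->
  let t := (assign_node e a r tie u i b s).1 in
  [/\ forall j v, (v != u) || (i < j) -> asg t (j, v) = asg s (j, v),
      forall j b', i < j -> wgt t (j, b') = wgt s (j, b'),
      forall j, 1 <= j <= i -> layer_inv (rcons p u) t j &
      forall j, 1 <= j <= i ->
        good (asg t) p u j (if j == i then b else odflt 0 (asg t (j.+1, u)))].
Proof.
move=> Up up; elim: i b s => [|i IH] b s lil Inv.
  by split=> // j /andP[/leq_trans h /h].
have li : 1 <= i.+1 <= l by [].
have Inv1 : layer_inv p s i.+1 by apply: Inv; rewrite leqnn.
have := assign_layer_result u b Up li Inv1.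
have -> : (assign_node e a r tie u i.+1 b s).1 =
  (assign_node e a r tie u i (assign_layer e a r tie u i.+1 b s).1.1
     (assign_layer e a r tie u i.+1 b s).1.2).1 by [].
move: (assign_layer _ _ _ _ _ _ _ _).1 => t1 /= [EA EW mem1 max1].
have Inv' j : 1 <= j <= i -> layer_inv p t1.2 j.
  move=> /andP[j0 ji]; have [h1 h2] : layer_inv p s j.
    by apply: Inv; rewrite j0 ltnW.
  have nj : j == i.+1 = false by rewrite ltn_eqF.
  split=> [v|b'].
    by rewrite EA /upd xpair_eqE nj; exact: h1.
  rewrite EW /upd xpair_eqE nj /= h2 /block_weight; apply: eq_count => v.
  by rewrite EA /upd xpair_eqE nj.
have := IH t1.1 t1.2 (ltnW lil) Inv'.
move: (assign_node _ _ _ _ _ _ _ _).1 => t /= [frame framew invt goodt].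
have At v : asg t (i.+1, v) = if v == u then Some t1.1 else asg s (i.+1, v).
  by rewrite frame ?ltnSn ?orbT // EA /upd xpair_eqE eqxx.
have Ap v : v \in p -> asg t (i.+1, v) = asg s (i.+1, v).
  by move=> vp; rewrite At; case: eqP => // vu; rewrite -vu vp in up.
split.
- move=> j v H; rewrite frame.
    rewrite EA /upd xpair_eqE; have [Ej|//] := eqVneq j i.+1.
    by move: H; rewrite Ej ltnn orbF => /negPf ->.
  by case/orP: H => [->//|/ltnW ->]; rewrite orbT.
- move=> j b' ltj; rewrite (framew _ _ (ltnW ltj)) EW /upd xpair_eqE.
  by rewrite (gtn_eqF ltj).
- move=> j /andP[j0]; rewrite leq_eqVlt => /orP[/eqP->|ji]; last first.
    by apply: invt; rewrite j0.
  split=> [v|b'].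
    rewrite At mem_rcons inE; case: eqP => //= _; exact: Inv1.1.
  have -> : wgt t (i.+1, b') = wgt t1.2 (i.+1, b').
    exact: framew.
  rewrite EW /upd xpair_eqE eqxx /= /block_weight -cats1 count_cat /= At eqxx.
  rewrite (eq_in_count (a2 := fun v => asg s (i.+1, v) == Some b')); last first.
    by move=> v /Ap ->.
  rewrite addn0 -[count _ _]/(block_weight (asg s) p i.+1 b') -!Inv1.2.
  have -> : (Some t1.1 == Some b') = (t1.1 == b') by [].
  by rewrite eq_sym; case: eqP => [->|_]; rewrite ?addn1 ?addn0.
- move=> j /andP[j0]; rewrite leq_eqVlt => /orP[/eqP->|ji].
    rewrite eqxx; exists t1.1; split=> //; first by rewrite At eqxx.
    by move=> b' /max1; rewrite !(block_score_ext _ _ Ap).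
  rewrite ltn_eqF //; have := goodt j; rewrite j0 => /(_ ji).
  by case: eqP => [->|//]; rewrite At eqxx.
Qed.

Lemma parent_ext (A B : nat * V -> option nat) (u : V) i :
  (forall j, A (j, u) = B (j, u)) -> parent l A i u = parent l B i u.
Proof. by move=> AB; rewrite /parent AB. Qed.

Lemma process_stream_result (us p : seq V) (s : state V) :
  uniq (p ++ us) -> (forall j, 1 <= j <= l -> layer_inv p s j) ->
  let t := (process_stream e l a r tie us s).1 in
  (forall j v, v \in p -> asg t (j, v) = asg s (j, v)) /\
  (forall q1 q2 u, us = q1 ++ u :: q2 -> forall i, 1 <= i <= l ->
     good (asg t) (p ++ q1) u i (parent l (asg t) i u)).
Proof.
elim: us p s => [|u us IH] p s Uus Inv.
  by split=> // -[].
have -> : (process_stream e l a r tie (u :: us) s).1 =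
  (process_stream e l a r tie us (assign_node e a r tie u l 0 s).1).1 by [].
have [Up up Uus'] : [/\ uniq p, u \notin p & uniq (rcons p u ++ us)].
  rewrite cat_rcons Uus; move: Uus; rewrite cat_uniq => /and3P[-> /= /norP[? _] _].
  by split.
have := assign_node_result 0 Up up (leqnn l) Inv.
move: (assign_node _ _ _ _ _ _ _ _).1 => t1 /= [frame _ invt goodt].
have := IH (rcons p u) t1 Uus' invt.
move: (process_stream _ _ _ _ _ _ _).1 => t /= [framet goodt'].
have tE j v : v \in p -> asg t (j, v) = asg t1 (j, v).
  by move=> vp; rewrite framet // mem_rcons inE vp orbT.
split=> [j v vp|].
  rewrite tE // frame //; case: eqP => // vu; by rewrite -vu vp in up.
case=> [|u' q1] q2 v /= [<- Eus] i li; last first.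
  by rewrite -cat_rcons; apply: (goodt' _ q2) => //.
rewrite cats0.
have tu j : asg t (j, u) = asg t1 (j, u).
  by rewrite framet // mem_rcons inE eqxx.
have [b1 [h1 h2 h3]] := goodt i li.
exists b1; rewrite tu (parent_ext _ tu); split=> // b' /h3.
by rewrite !(block_score_ext _ _ (tE i)).
Qed.

Lemma multisectionP (arrivals : seq V) :
  uniq arrivals ->
  online_multisection e l a r arrivals
    (asg (result (multisection e l a r tie arrivals))).
Proof.
move=> Ua p q u Ea i li; rewrite /result /multisection.
have Inv0 j : 1 <= j <= l -> layer_inv [::] (init_state V) j by split.
by have [_ H] := process_stream_result (p := [::]) Ua Inv0; apply: H Ea _ li.
Qed.

End Correctness.

(* Main.v *)
(** In layer [i] a node [u] costs a constant number of steps per neighbor (tally)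
    and per candidate block (reset and scoring), hence [O(deg u + a i)].
    Summing over the layers gives [O(l * deg u + \sum_i a i)] per node, the
    constant overhead of each layer being absorbed since [a i >= 1]; summing over
    the nodes, the handshake lemma bounds the total degree by [2 m]. *)

Require Import Defs.
From mathcomp Require Import all_boot all_order all_algebra.
From mathcomp Require Import reals exp.
From mathcomp Require Import zify.

Local Arguments time : simpl never.
Local Arguments bind : simpl never.

Lemma time_bind (A B : Type) (m : timed A) (f : A -> timed B) :
  time (bind m f) = time m + time (f (result m)).
Proof. by []. Qed.

Lemma time_step (A : Type) (x : A) : time (step x) = 1.
Proof. by []. Qed.

Lemma time_ret (A : Type) (x : A) : time (ret x) = 0.
Proof. by []. Qed.

Definition timeE := (time_bind, time_step, time_ret).

(** The successor on [B] pays for the step opening each iteration, the final [1] for the test that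
    leaves the loop. *)
Lemma time_loop_le (X S : Type) (B : nat) (body : X -> S -> timed S)
    (xs : seq X) (s : S) :
  (forall x s, time (body x s) <= B) ->
  time (loop xs s body) <= B.+1 * size xs + 1.
Proof.
move=> bodyB; elim: xs s => [|x xs IH] s; first by rewrite muln0.
rewrite /= !timeE mulnS; have := bodyB x s.
by have := IH (result (body x s)); lia.
Qed.

Lemma time_tally_le (V : finType) (e : rel V) (u : V)
    (A : nat * V -> option nat) (i lo ai : nat) (c0 : nat -> nat) :
  time (Defs.tally e u A i lo ai c0) <= 9 * size (nbrs e u) + 2 * ai + 2.
Proof.
rewrite /Defs.tally timeE.
set t1 := loop _ c0 _; set t2 := loop _ _ _.
have : time t1 <= 2 * size (iota 0 ai) + 1 by apply: time_loop_le.
have : time t2 <= 9 * size (nbrs e u) + 1.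
  (* The longest branch, where [v] lies in a candidate block, takes 8 steps. *)
  apply: time_loop_le => v c; rewrite !timeE /result /=.
  case: (isSome _) => //=; rewrite !timeE /result /=.
  by case: (lo <= _) => //; rewrite !timeE /result /=; case: (_ < ai).
by rewrite size_iota; lia.
Qed.

Lemma time_timed_score_le (R : realType) (r : rule R) (i d w : nat) :
  time (timed_score r i d w) <= 8.
Proof. by case: r. Qed.

Lemma time_best_candidate_le (R : realType) (r : rule R) (tie : nat -> bool)
    (W : nat * nat -> nat) (c : nat -> nat) (i lo ai : nat) :
  time (best_candidate r tie W c i lo ai) <= 17 * ai + 1.
Proof.
(* 16 steps per candidate: 3 reads, 8 for the score, 1 test of [best], and at most 4 for the
   comparison and tie-break. *)
rewrite -[ai in _ * ai](size_iota 0); apply: time_loop_le => j best.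
rewrite 4!time_bind; set sc := timed_score _ _ _ _.
rewrite time_bind !time_step; set rest := time (if _ then _ else _).
have rest_le : rest <= 4.
  rewrite /rest; case: ifP => // _; rewrite time_bind; case: ifP => // _.
  by rewrite time_bind; case: ifP => // _; rewrite time_bind; case: ifP.
by have : time sc <= 8 := time_timed_score_le R r _ _ _; lia.
Qed.

(** Here 19 = 2 + 17 joins reset and scoring; 10 is the 3 loop exits plus the 7 steps outside the
    loops. *)
Lemma time_assign_layer_le (R : realType) (V : finType) (e : rel V)
    (a : nat -> nat) (r : rule R) (tie : V -> nat -> nat -> bool)
    (u : V) (i b : nat) (s : state V) :
  time (assign_layer e a r tie u i b s)
    <= 9 * size (nbrs e u) + 19 * a i + 10.
Proof.
rewrite /assign_layer 3!time_bind.
move: (Defs.tally _ _ _ _ _ _ _)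
  (time_tally_le V e u (asg s) i (b * a i) (a i) (cnt s)) => t1 le1.
rewrite time_bind.
move: (best_candidate _ _ _ _ _ _ _)
  (time_best_candidate_le R r (tie u i) (wgt s) (result t1) i (b * a i) (a i))
  => t2 le2.
by rewrite !timeE; lia.
Qed.

(** Testing and decrementing [i] raise the overhead of a layer from 10 to 12; the last [1] is the
    test at [i = 0]. *)
Lemma time_assign_node_le (R : realType) (V : finType) (e : rel V)
    (a : nat -> nat) (r : rule R) (tie : V -> nat -> nat -> bool)
    (u : V) (i b : nat) (s : state V) :
  time (assign_node e a r tie u i b s)
    <= 9 * size (nbrs e u) * i + 19 * \sum_(1 <= j < i.+1) a j + 12 * i + 1.
Proof.
elim: i b s => [|i IH] b s; first by rewrite big_geq // !muln0.
rewrite big_nat_recr //= 2!time_bind.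
move: (assign_layer _ _ _ _ _ _ _ _)
  (time_assign_layer_le R V e a r tie u i.+1 b s) => t1 le1.
rewrite time_bind !time_step mulnS; have := IH (result t1).1 (result t1).2.
by lia.
Qed.

(** [B] depends on the node and not on the state, so the resulting sum is insensitive to the arrival
    order. *)
Lemma time_process_stream_le (R : realType) (V : finType) (e : rel V) (l : nat)
    (a : nat -> nat) (r : rule R) (tie : V -> nat -> nat -> bool)
    (B : V -> nat) (arrivals : seq V) (s : state V) :
  (forall u s, time (assign_node e a r tie u l 0 s) <= B u) ->
  time (process_stream e l a r tie arrivals s)
    <= \sum_(u <- arrivals) (B u).+1.
Proof.
move=> nodeB; elim: arrivals s => [|u us IH] s; first by rewrite big_nil.
rewrite big_cons /= !timeE; have := nodeB u s.
by have := IH (result (assign_node e a r tie u l 0 s)); lia.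
Qed.

Lemma set2_eq (T : finType) (x y z w : T) :
  [set z; w] = [set x; y] -> (z, w) = (x, y) \/ (z, w) = (y, x).
Proof.
move=> E; have : z \in [set x; y] by rewrite -E set21.
have : w \in [set x; y] by rewrite -E set22.
have : x \in [set z; w] by rewrite E set21.
have : y \in [set z; w] by rewrite E set22.
by rewrite !inE => /orP[]/eqP ? /orP[]/eqP ? /orP[]/eqP ? /orP[]/eqP ?;
   subst; auto.
Qed.

(* Each edge is the image of at most two ordered pairs. *)
Lemma sum_degree_le (V : finType) (e : rel V) :
  \sum_(u in V) size (nbrs e u) <= 2 * #|edges e|.
Proof.
pose D := [set p : V * V | e p.1 p.2].
pose f (p : V * V) := [set p.1; p.2].
(* The degree sum counts ordered adjacent pairs, which are then grouped by the edge they span. *)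
have -> : \sum_(u in V) size (nbrs e u) = \sum_(p in D) 1.
  under eq_bigr => u _ do rewrite /nbrs -cardE -sum1_card.
  by rewrite pair_big_dep /=; apply: eq_bigl => p; rewrite inE.
rewrite (partition_big_imset f) /=.
have -> : f @: D = edges e.
  apply/setP => E; apply/imsetP/imsetP => -[p pD ->]; exists p => //;
    by move: pD; rewrite !inE.
rewrite mulnC -sum_nat_const; apply: leq_sum => _ /imsetP[[x y] _ ->].
rewrite sum1_card.
apply: leq_trans (_ : #|[set (x, y); (y, x)]| <= 2); last first.
  by rewrite cards2; case: (_ != _).
apply/subset_leq_card/subsetP => -[z w]; rewrite unfold_in => /andP[_ /eqP].
by case/set2_eq => ->; rewrite ?set21 ?set22.
Qed.

Theorem theorem2 (R : realType) :
  exists C : nat,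
  forall (V : finType) (e : rel V), symmetric e -> irreflexive e ->
  forall (n m : nat), #|V| = n -> #|edges e| = m ->
  forall (l : nat) (a : nat -> nat) (k : nat),
    1 <= l -> (forall i : nat, 1 <= i <= l -> 2 <= a i) ->
    k = \prod_(1 <= i < l.+1) a i ->
  forall (r : rule R) (tie : V -> nat -> nat -> bool) (arrivals : seq V),
    perm_eq arrivals (enum V) ->
  time (multisection e l a r tie arrivals)
    <= C * (m * l + n * \sum_(1 <= i < l.+1) a i).
Proof.
(* 33 is the coefficient of [n * S] found below; that of [m * l] is only 9 * 2 = 18. *)
exists 33 => V e _ _ n m <- <- l a k l_gt0 a_ge2 _ r tie arrivals arrV.
set S := \sum_(1 <= i < l.+1) a i.
have le_lS : l <= S.
  rewrite -[l in l <= _](subn1 l.+1) -[_ - 1]muln1 -sum_nat_const_nat.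
  rewrite /S big_nat_cond [\sum_(1 <= _ < _) _]big_nat_cond.
  by apply: leq_sum => i /andP[/a_ge2 /ltnW].
(* 32 = 19 + 12 + 1, since [l <= S] bounds [12 * l] by [12 * S] and [1 <= l] bounds the last step by
   [S]. *)
pose B u := 9 * l * size (nbrs e u) + 32 * S.
have nodeB u s : time (assign_node e a r tie u l 0 s) <= B u.
  apply: leq_trans (time_assign_node_le R V e a r tie u l 0 s) _.
  by rewrite /B -/S mulnAC; lia.
apply: leq_trans (time_process_stream_le _ _ _ _ _ _ _ _ _ _ nodeB) _.
rewrite (perm_big _ arrV) big_enum /=.
under eq_bigr => u _ do rewrite /B -addnS.
rewrite big_split /= -big_distrr sum_nat_const /=.
(* The step charged for each arrival is absorbed because [S] is positive. *)
have : #|V| * (32 * S).+1 <= #|V| * (33 * S) by rewrite leq_mul2l; lia.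
have := leq_mul (leqnn (9 * l)) (sum_degree_le V e).
move: (\sum_(u in V) _) #|edges e| => X M.
by nia.
Qed.
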